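(* Let $\mu,\lambda,\nu$ be partitions. Then there exists a polynomial $f_{\mu\lambda}^\nu(x)\in\mathbb{Q}[x]$ such that $b_{\mu\lambda}^\nu(n)=2^{\,n-w(\nu)}\,n!\,f_{\mu\lambda}^\nu(n)$ for all sufficiently large integers $n$.
   Context: Partitions: $l(\mu)$ number of nonzero parts, $|\mu|$ sum of parts, $w(\mu)=l(\mu)+|\mu|$. $S_{2n}$ is the symmetric group on $[2n]$, $B_n$ the centralizer in $S_{2n}$ of $(1\,2)(3\,4)\cdots(2n-1\,2n)$, and $S_{2\infty}=\bigcup_n S_{2n}$. For $x\in S_{2n}$ the graph $\Gamma_x$ has vertices $v_i=(i,x(i))$, $i\in[2n]$, straight edges $(v_{2i-1}:v_{2i})$ and curved edges $(v_{x^{-1}(2i-1)}:v_{x^{-1}(2i)})$, $i=1,\dots,n$; if its components have sizes $2s_1\ge\dots\ge 2s_k$, the stable coset type $\mu_x$ is the partition with parts $s_j-1$ (zeros discarded), independent of $n$. $K_\mu=\{x\in S_{2\infty}:\mu_x=\mu\}$ and $K_\mu(n)=K_\mu\cap S_{2n}$; each nonempty $K_\mu(n)$ is a $B_n$-double coset in $S_{2n}$. The structure constant $b_{\mu\lambda}^\nu(n)$ is the coefficient of $\sum_{z\in K_\nu(n)}z$ in the product $\big(\sum_{x\in K_\mu(n)}x\big)\big(\sum_{y\in K_\lambda(n)}y\big)$ in $\mathbb{Z}[S_{2n}]$ (equivalently, the number of $(x,y)\in K_\mu(n)\times K_\lambda(n)$ with $xy=z$ for any fixed $z\in K_\nu(n)$).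 *)

(* Defs.v *)
From HB Require Import structures.
From mathcomp Require Import all_boot all_order all_algebra all_fingroup.

Set Implicit Arguments.
Unset Strict Implicit.
Unset Printing Implicit Defensive.

Import GRing.Theory.

Local Open Scope nat_scope.

(* Partitions are the weakly decreasing sequences of positive integers. *)
Definition is_part (mu : seq nat) : bool := sorted geq mu && (0 \notin mu).

Definition part_length (mu : seq nat) : nat := size mu.
Definition part_size (mu : seq nat) : nat := sumn mu.
Definition part_w (mu : seq nat) : nat := part_length mu + part_size mu.

Section CosetType.

Variable n : nat.

(* [2n] is 'I_(2 * n), so the pairs {2i-1, 2i} become {2k, 2k+1}, the
   two-element fibres of halving. *)
Definition paired (i j : 'I_(2 * n)) : bool := (i != j) && (i./2 == j./2).

(* The vertex v_i = (i, x(i)) of Gamma_x is represented by its index i. *)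
Definition straight_edge : rel 'I_(2 * n) := [rel i j | paired i j].

(* v_{x^-1(2k-1)} and v_{x^-1(2k)} are the vertices whose images under x form
   a pair. *)
Definition curved_edge (x : 'S_(2 * n)) : rel 'I_(2 * n) :=
  [rel i j | paired (x i) (x j)].

Definition Gamma (x : 'S_(2 * n)) : rel 'I_(2 * n) :=
  [rel i j | straight_edge i j || curved_edge x i j].

Definition components (x : 'S_(2 * n)) : {set {set 'I_(2 * n)}} :=
  [set [set j | connect (Gamma x) i j] | i : 'I_(2 * n)].

(* Components have even size 2s, and contribute the part s - 1. *)
Definition stable_coset_type (x : 'S_(2 * n)) : seq nat :=
  sort geq
    [seq s <- [seq (#|C|./2).-1 | C : {set 'I_(2 * n)} <- enum (components x)]
    | s != 0].

End CosetType.

(* K_mu(n); since the stable coset type of a permutation does not depend on the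
   n for which it is viewed in S_{2n}, this is K_mu intersected with S_{2n}. *)
Definition K (mu : seq nat) (n : nat) : {set 'S_(2 * n)} :=
  [set x | stable_coset_type x == mu].

(* The group ring Z[G] of a finite group G: a : {ffun G -> int} stands for
   \sum_x a(x) x. *)
Section GroupRing.

Variable gT : finGroupType.

Definition gring_elt (x : gT) : {ffun gT -> int} :=
  [ffun y => ((y == x)%:R)%R].

Definition gring_mul (a b : {ffun gT -> int}) : {ffun gT -> int} :=
  [ffun z => (\sum_x \sum_(y | (x * y)%g == z) a x * b y)%R].

Definition set_sum (A : {set gT}) : {ffun gT -> int} :=
  (\sum_(x in A) gring_elt x)%R.

End GroupRing.

(* b_{mu la}^nu(n). The product of the sums over K_mu(n) and K_la(n) is constant
   on the double coset K_nu(n), so the coefficient of the sum over K_nu(n) is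
   read off at any of its elements; the value is 0 by convention if K_nu(n) is
   empty, which happens only for n < w(nu). The product of 'S_(2 * n) applies
   its left factor first; since every K_mu(n) is stable under inversion, the
   opposite convention gives the same numbers. *)
Definition structure_const (mu la nu : seq nat) (n : nat) : int :=
  if [pick z in K nu n] is Some z
  then gring_mul (set_sum (K mu n)) (set_sum (K la n)) z
  else 0%R.

(* Main.v *)
Require Import Defs.
From HB Require Import structures.
From mathcomp Require Import all_boot all_order all_algebra all_fingroup.
From mathcomp Require Import zify.

(* Identify a perfect matching with its fixed-point-free involution and let e
   be the standard one. The graph of x is e together with the matching
   x^-1 e x, so counting the x that yield a given matching (always 2^n n!)
   reduces the theorem to this: for a matching f of type nu relative to e, the
   number of matchings m with (e, m) of type mu and (m, f) of type la is
   polynomial in n. Sort these m by the set A of points where e, m and f do not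
   all agree. Pairs of matchings of the same type on sets of the same size are
   isomorphic, since their union is a disjoint union of even cycles; hence the
   number of m belonging to A depends only on #|A| = 2 (w(nu) + k), where
   k <= w(mu), and there are binomial (n - w(nu), k) such sets A. *)

Set Implicit Arguments.
Unset Strict Implicit.
Unset Printing Implicit Defensive.

Import GRing.Theory.

Local Open Scope nat_scope.

(** * Pairs of matchings and their alternating cycles *)

Section Matchings.

Variable T : finType.
Implicit Types (e f : T -> T) (i j : T).

Definition matching e : bool := [forall i, (e (e i) == i) && (e i != i)].

Lemma matchingP e :
  reflect (involutive e /\ forall i, e i != i) (matching e).
Proof.
apply: (iffP forallP) => [eP|[eK eN] i]; last by rewrite eK eqxx eN.
by split=> i; have /andP[/eqP] := eP i.
Qed.

Lemma eq_matching e f : e =1 f -> matching e = matching f.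
Proof. by move=> ef; apply: eq_forallb => i; rewrite !ef. Qed.

Definition adj e f : rel T := [rel i j | (j == e i) || (j == f i)].

Definition ccomp e f i : {set T} := [set j | connect (adj e f) i j].

Definition ccomps e f : {set {set T}} := [set ccomp e f i | i : T].

(** Same recipe as [stable_coset_type], but on any finite type, so that types can be compared across
    different carriers. *)
Definition ctype e f : seq nat :=
  sort geq
    [seq s <- [seq (#|C|./2).-1 | C : {set T} <- enum (ccomps e f)] | s != 0].

(** Even positions are left by [e] and odd ones by [f]; this walk parametrises the cycle through
    [i]. *)
Fixpoint walk e f i k :=
  if k is l.+1 then (if odd l then f else e) (walk e f i l) else i.

Lemma eq_comp e f e' f' : e =1 e' -> f =1 f' -> ccomp e f =1 ccomp e' f'.
Proof.
move=> ee ff i; apply/setP=> j; rewrite !inE.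
by apply: eq_connect => a b; rewrite /adj /= ee ff.
Qed.

Lemma eq_comps e f e' f' : e =1 e' -> f =1 f' -> ccomps e f = ccomps e' f'.
Proof. by move=> ee ff; apply: eq_imset; apply: eq_comp. Qed.

Lemma eq_ctype e f e' f' : e =1 e' -> f =1 f' -> ctype e f = ctype e' f'.
Proof. by move=> ee ff; rewrite /ctype (eq_comps ee ff). Qed.

Section Pair.

Variables e f : T -> T.
Hypotheses (eM : matching e) (fM : matching f).

Let eK : involutive e. Proof. by have /matchingP[] := eM. Qed.
Let eN i : e i != i. Proof. by have /matchingP[] := eM. Qed.
Let fK : involutive f. Proof. by have /matchingP[] := fM. Qed.
Let fN i : f i != i. Proof. by have /matchingP[] := fM. Qed.

Lemma adj_sym : symmetric (adj e f).
Proof.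
move=> i j /=; congr (_ || _); apply/eqP/eqP => ->.
- by rewrite eK. - by rewrite eK. - by rewrite fK. - by rewrite fK.
Qed.

Lemma adj_connect_sym : connect_sym (adj e f).
Proof. exact: sym_connect_sym adj_sym. Qed.

Lemma mem_comp i : i \in ccomp e f i.
Proof. by rewrite inE connect0. Qed.

Lemma comp_eq i j : (ccomp e f i == ccomp e f j) = (j \in ccomp e f i).
Proof.
apply/eqP/idP => [->|]; first exact: mem_comp.
rewrite inE => ij; apply/setP=> k; rewrite !inE.
exact: (same_connect adj_connect_sym).
Qed.

Lemma comp_e i : ccomp e f (e i) = ccomp e f i.
Proof.
by apply/esym/eqP; rewrite comp_eq inE; apply: connect1; rewrite /adj /= eqxx.
Qed.

Lemma comp_f i : ccomp e f (f i) = ccomp e f i.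
Proof.
by apply/esym/eqP; rewrite comp_eq inE; apply: connect1; rewrite /adj /= eqxx orbT.
Qed.

Lemma comp_walk i k : ccomp e f (walk e f i k) = ccomp e f i.
Proof. by elim: k => //= k <-; case: odd; rewrite ?comp_e ?comp_f. Qed.

(* A closed stretch of odd length would be its own reversal, and its middle
   edge would join a point to itself. *)
Lemma walk_parity i a b : walk e f i a = walk e f i b -> odd a = odd b.
Proof.
wlog: a b / a <= b => [th|].
  by move=> eqab; case/orP: (leq_total a b) => /th; [apply | move/(_ (esym eqab))].
move=> /subnKC <-; move: (b - a) => d {b}.
have [k] := ubnP d; elim: k d a => // k IH d a dk eqab.
rewrite oddD; case oddd: (odd d); last by rewrite addbF.
case: d => [|[|d]] // in dk eqab oddd *.
  move: eqab; rewrite addn1 /=; case: odd => /esym/eqP.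
    by rewrite (negPf (fN _)).
  by rewrite (negPf (eN _)).
(* The first and the last step of the stretch use the same involution, so removing both leaves a
   closed stretch shorter by two. *)
have := IH d a.+1; rewrite oddD addSn -addnS.
have -> : odd d = true by move: oddd; rewrite /= negbK.
move=> /(_ _ _) th; exfalso; suff: odd a.+1 = odd a.+1 (+) true by case: odd.
apply: th; first by lia.
move: eqab; rewrite !addnS /= oddD.
have -> : odd d = true by move: oddd; rewrite /= negbK.
by rewrite addbT; case: odd => /= ->; rewrite ?eK ?fK.
Qed.

(** By parity [d] is even, so both walks end with the same involution, which can be cancelled one
    step at a time. *)
Lemma walk_shift i a d :
  walk e f i a = walk e f i (a + d) -> i = walk e f i d.
Proof.
move=> eqa; have := walk_parity eqa; rewrite oddD.
case dd: (odd d); first by rewrite addbT; case: odd.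
move=> _; elim: a eqa => [//|a IH]; rewrite addSn /= oddD dd addbF => eqa.
by apply: IH; move: eqa; case: odd => /(congr1 f) => [|/(congr1 f)/(congr1 e)];
  rewrite ?fK ?eK.
Qed.

Lemma walk_period i p a :
  i = walk e f i p -> walk e f i (a + p) = walk e f i a.
Proof.
move=> ip; have := walk_parity (a := 0) ip => /= pp.
by elim: a => [|a IH] //; rewrite addSn /= oddD -pp addbF IH.
Qed.

(** Pigeonhole on [#|T| + 1] positions gives a repetition, which is then shifted back to the
    start. *)
Lemma walk_return i : exists p, (0 < p) && (i == walk e f i p).
Proof.
have /injectivePn[a [b ab eqab]] :
  ~~ injectiveb (fun k : 'I_#|T|.+1 => walk e f i k).
  apply/negP=> /injectiveP /leq_card; rewrite card_ord; lia.
wlog: a b ab eqab / a < b => [th|lt_ab].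
  have: (a < b) || (b < a) by rewrite -neq_ltn.
  by case/orP=> [/(th a b)|/(th b a)]; apply=> //; rewrite eq_sym.
exists (b - a); rewrite subn_gt0 lt_ab; apply/eqP.
by apply: (@walk_shift i a); rewrite subnKC // ltnW.
Qed.

(** The period is the least return time. The points visited are closed under both kinds of edges,
    since [e] and [f] only move to a neighbouring position, so they fill the component. *)
Lemma walk_cycle i : exists2 p, 0 < p /\ ~~ odd p &
  (forall a b, walk e f i a = walk e f i b <-> a = b %[mod p]) /\
  ccomp e f i = [set walk e f i (k : 'I_p) | k : 'I_p].
Proof.
have /ex_minnP[p /andP[p_gt0 /eqP ip] pmin] := walk_return i.
have wp k a : walk e f i (a + k * p) = walk e f i a.
  by elim: k a => [|k IH] a; rewrite ?addn0 // mulSn addnA IH walk_period.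
have wm a : walk e f i (a %% p) = walk e f i a.
  by rewrite [in RHS](divn_eq a p) addnC wp.
have podd : ~~ odd p by have := walk_parity (a := 0) ip => /= <-.
exists p; first by [].
have inj a b : a < p -> b < p -> walk e f i a = walk e f i b -> a = b.
  wlog: a b / a <= b => [th|ab ap bp eqab].
    by move=> ap bp eqab; case/orP: (leq_total a b) => /th h;
      [apply: h|apply/esym/h].
  have /walk_shift iba : walk e f i a = walk e f i (a + (b - a)).
    by rewrite subnKC.
  case: (posnP (b - a)) => [|ba]; first by lia.
  have := pmin (b - a); rewrite ba -iba eqxx => /(_ isT); lia.
split=> [a b|].
  split=> [|ab]; last by rewrite -wm ab wm.
  by rewrite -(wm a) -(wm b) => /inj; apply; rewrite ltn_mod.
apply/setP=> j; apply/idP/imsetP => [|[k _ ->]]; last first.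
  by rewrite -comp_eq comp_walk.
rewrite inE => /connectP[s ]; elim/last_ind: s j => [j _ ->|s x IH j].
  by exists (Ordinal p_gt0).
rewrite rcons_path last_rcons => /andP[/IH {}IH ad] ->{j}.
have [k _ lk] := IH _ erefl.
suff [k' ->] : exists k', x = walk e f i k'.
  have k'p : k' %% p < p by rewrite ltn_mod.
  by exists (Ordinal k'p); rewrite //= wm.
move: ad => /= /orP[] /eqP ->; rewrite lk; case ok: (odd k).
- by case: (nat_of_ord k) ok => //= l /negbTE ol; exists l; rewrite ol eK.
- by exists k.+1; rewrite /= ok.
- by exists k.+1; rewrite /= ok.
(* An [f]-edge at an even position leads one position back; adding the period first gives position 0
   a predecessor. *)
exists (k + p).-1; rewrite -{1}(walk_period k ip).
have : ~~ odd (k + p) by rewrite oddD ok (negPf podd).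
by case: (k + p) (addn_gt0 k p) => [|l] /=; rewrite ?p_gt0 ?orbT ?negbK // => _ ->; rewrite fK.
Qed.

Lemma walk_eqP i a b :
  walk e f i a = walk e f i b <-> a = b %[mod #|ccomp e f i|].
Proof.
have [p _ [wP ->]] := walk_cycle i; rewrite card_imset ?card_ord //.
by move=> x y /wP; rewrite !modn_small // => /val_inj.
Qed.

Lemma comp_even i : ~~ odd #|ccomp e f i|.
Proof.
have [p [_ ?] [wP ->]] := walk_cycle i; rewrite card_imset ?card_ord //.
by move=> x y /wP; rewrite !modn_small // => /val_inj.
Qed.

Lemma comp_card_gt0 i : 0 < #|ccomp e f i|.
Proof. by apply/card_gt0P; exists i; apply: mem_comp. Qed.

Lemma compP i j : reflect (exists k, j = walk e f i k) (j \in ccomp e f i).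
Proof.
apply: (iffP idP) => [|[k ->]]; last by rewrite -comp_eq comp_walk.
by have [p _ [_ ->]] := walk_cycle i => /imsetP[k _ ->]; exists k.
Qed.

Lemma e_walk i k : e (walk e f i k) = walk e f i (if odd k then k.-1 else k.+1).
Proof.
case ok: (odd k); last by rewrite /= ok.
by case: k ok => //= k /negbTE ->; rewrite eK.
Qed.

(** Adding the cycle length avoids truncated subtraction at position 0. *)
Lemma f_walk i k : f (walk e f i k) =
  walk e f i (if odd k then k.+1 else (k + #|ccomp e f i|).-1).
Proof.
case ok: (odd k); first by rewrite /= ok.
have <- : walk e f i (k + #|ccomp e f i|) = walk e f i k.
  by apply/walk_eqP; rewrite modnDr.
have : ~~ odd (k + #|ccomp e f i|) by rewrite oddD ok (negPf (comp_even i)).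
have : 0 < k + #|ccomp e f i| by rewrite addn_gt0 comp_card_gt0 orbT.
by case: (k + _) => //= l _; rewrite negbK => ->; rewrite fK.
Qed.

Lemma ccomps_partition : partition (ccomps e f) [set: T].
Proof.
have -> : ccomps e f = equivalence_partition (connect (adj e f)) [set: T].
  apply/setP=> C; apply/imsetP/imsetP => -[i _ ->]; exists i => //;
    by apply/setP=> j; rewrite !inE.
apply: equivalence_partitionP => i j k _ _ _; split; first exact: connect0.
by move=> ij; apply: (same_connect adj_connect_sym).
Qed.

Lemma ccomps_even C : C \in ccomps e f -> ~~ odd #|C| /\ 1 < #|C|.
Proof.
case/imsetP=> i _ ->; have := comp_even i; have := comp_card_gt0 i; lia.
Qed.

Lemma ctype_count s : count_mem s (ctype e f) =
  if s == 0 then 0 else #|[set C in ccomps e f | #|C| == 2 * s.+1]|.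
Proof.
rewrite /ctype count_sort; case: (eqVneq s 0) => [->|s0].
  by apply/count_memPn; rewrite mem_filter.
rewrite count_filter count_map -size_filter cardE; apply: perm_size.
apply: uniq_perm => [||C]; [|exact: enum_uniq|].
  by rewrite filter_uniq // enum_uniq.
rewrite mem_filter !mem_enum !inE /= andbC.
by case CP: (C \in _) => //=; have := ccomps_even CP; lia.
Qed.

(** A component of size 2(s + 1) yields the part s, which contributes s + 1 to [part_w]; the
    discarded zero parts come from the components of size 2. *)
Lemma ctype_mass :
  \sum_(C in ccomps e f | #|C| != 2) #|C| = 2 * part_w (ctype e f).
Proof.
have -> (t : seq nat) : part_w t = \sum_(s <- t) s.+1.
  rewrite /part_w /part_length /part_size.
  by elim: t => [|s t IH]; rewrite ?big_nil // big_cons -IH /=; lia.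
rewrite (perm_big _ (permEl (perm_sort _ _))) big_filter big_map big_distrr /=.
rewrite big_enum_cond /=; apply: eq_big => C; last first.
  by case/andP=> /ccomps_even; lia.
by case CP: (C \in _) => //=; have := ccomps_even CP; lia.
Qed.

(** Components of size 2 leave no trace in the type; the size of [T] recovers their number. *)
Lemma card_ctype :
  #|T| = 2 * #|[set C in ccomps e f | #|C| == 2]| + 2 * part_w (ctype e f).
Proof.
rewrite -cardsT (card_partition ccomps_partition).
rewrite (bigID (fun C : {set T} => #|C| == 2)) /=.
rewrite ctype_mass; congr (_ + _).
rewrite (eq_bigr (fun=> 2)) => [|C /andP[_ /eqP] //].
by rewrite sum_nat_const mulnC; congr (_ * _); rewrite cardsE; apply: eq_card => C.
Qed.

End Pair.
End Matchings.

(** * Classification of pairs of matchings up to isomorphism *)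

Section TwoMatchedPairs.

Variables (T T' : finType) (e f : T -> T) (e' f' : T' -> T').
Hypotheses (eM : matching e) (fM : matching f).
Hypotheses (eM' : matching e') (fM' : matching f').

(** Both types are sorted, so equal multiplicities of their parts suffice. *)
Lemma ctype_eq_counts :
  (forall s, s != 0 -> #|[set C in ccomps e f | #|C| == 2 * s.+1]|
                     = #|[set C in ccomps e' f' | #|C| == 2 * s.+1]|) ->
  ctype e f = ctype e' f'.
Proof.
move=> cnt; rewrite -[LHS](sorted_sort (leT := geq)).
- rewrite -[RHS](sorted_sort (leT := geq)).
  + apply/perm_sortP.
    * by move=> a b; rewrite /= orbC leq_total.
    * by move=> a b c ab ca; apply: leq_trans ab.
    * by move=> a b /=; lia.
    apply/allP=> s _; rewrite /= !ctype_count //.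
    by case: (eqVneq s 0) => // /cnt ->.
  + by move=> a b c ab ca; apply: leq_trans ab.
  + by apply: sort_sorted => a b; rewrite /= orbC leq_total.
- by move=> a b c ab ca; apply: leq_trans ab.
- by apply: sort_sorted => a b; rewrite /= orbC leq_total.
Qed.

(** Odd sizes and size 0 do not occur, size 2 is settled by the total cardinality, and every larger
    size is a multiplicity in the type. *)
Lemma ccomps_card_eq : ctype e f = ctype e' f' -> #|T| = #|T'| ->
  forall s, #|[set C in ccomps e f | #|C| == s]|
          = #|[set C in ccomps e' f' | #|C| == s]|.
Proof.
move=> ct cT s; case: (boolP (odd s || (s <= 1))) => [s_odd|].
  rewrite !eq_card0 // => C; rewrite !inE; apply/andP => -[CP /eqP Cs].
    by have := ccomps_even eM' fM' CP; lia.
  by have := ccomps_even eM fM CP; lia.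
case: (eqVneq s 2) => [-> _|s2 se].
  have := card_ctype eM fM; have := card_ctype eM' fM'; rewrite ct cT; lia.
have -> : s = 2 * (s./2.-1).+1 by lia.
have := congr1 (count_mem s./2.-1) ct; rewrite !ctype_count //.
by case: eqP => // ?; lia.
Qed.

Section Embedding.

Variable h : T -> T'.
Hypotheses (h_inj : injective h).
Hypotheses (he : forall i, h (e i) = e' (h i)) (hf : forall i, h (f i) = f' (h i)).

Lemma walk_embed i k : h (walk e f i k) = walk e' f' (h i) k.
Proof. by elim: k => //= k <-; case: odd; rewrite ?he ?hf. Qed.

Lemma comp_embed i : ccomp e' f' (h i) = h @: ccomp e f i.
Proof.
apply/setP=> y; apply/compP/imsetP => // [[k ->]|[j]].
  by exists (walk e f i k); rewrite ?walk_embed //; apply/compP => //; exists k.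
by case/compP=> // k -> ->; exists k; rewrite walk_embed.
Qed.

(** Components inside the image of [h] are images of components; outside it the matchings agree, so
    components there have two points and give no part. *)
Lemma ctype_embed : (forall y, y \notin codom h -> f' y = e' y) ->
  ctype e f = ctype e' f'.
Proof.
move=> off; apply: ctype_eq_counts => s s0; set P := [set C in _ | _].
rewrite -(card_imset _ (imset_inj h_inj)) /=; apply: eq_card => C'.
apply/imsetP/idP => [[C CP ->]|].
  move: CP; rewrite !inE card_imset // => /andP[/imsetP[i _ ->] ->].
  by rewrite andbT -comp_embed imset_f.
rewrite inE => /andP[/imsetP[y _ ->]]; case: (boolP (y \in codom h)).
  case/codomP=> i ->; rewrite comp_embed card_imset // => iP.
  by exists (ccomp e f i); rewrite // inE iP imset_f.
move=> yh; suff : #|ccomp e' f' y| <= 2 by lia.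
suff /subset_leq_card : ccomp e' f' y \subset [set y; e' y].
  by rewrite cards2; lia.
have [e'K _] := matchingP _ eM'.
have yh' : e' y \notin codom h.
  apply: contra yh => /codomP[i ei]; apply/codomP; exists (e i).
  by rewrite he -ei e'K.
apply/subsetP=> j /compP -[] // k ->{j}; elim: k => [|k]; first by rewrite set21.
by move=> /= /set2P[] ->; case: odd; rewrite ?off ?e'K ?set21 ?set22.
Qed.

End Embedding.

End TwoMatchedPairs.

(** Within each label, an element goes to the one of the same rank in the enumeration of the
    target. *)
Lemma label_preserving_injection (A B : finType) (P : {set A}) (Q : {set B})
    (b0 : B) (la : A -> nat) (lb : B -> nat) :
  (forall s, #|[set x in P | la x == s]| = #|[set y in Q | lb y == s]|) ->
  exists g : A -> B, (forall x, x \in P -> g x \in Q /\ lb (g x) = la x)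
    /\ {in P &, injective g}.
Proof.
move=> PQ; pose Ps s := [set x in P | la x == s].
pose Qs s := [set y in Q | lb y == s].
pose g x := nth b0 (enum (Qs (la x))) (index x (enum (Ps (la x)))).
have idx x : x \in P -> index x (enum (Ps (la x))) < size (enum (Qs (la x))).
  by move=> xP; rewrite -cardE -PQ cardE index_mem mem_enum inE xP /=.
have gP x : x \in P -> g x \in Q /\ lb (g x) = la x.
  by move/idx/(mem_nth b0); rewrite mem_enum inE => /andP[? /eqP].
exists g; split=> // x y xP yP gxy.
have lxy : la x = la y by rewrite -(gP x xP).2 -(gP y yP).2 gxy.
move: gxy (idx x xP) (idx y yP); rewrite /g lxy => gxy ix iy.
have /eqP := gxy; rewrite nth_uniq ?enum_uniq // => /eqP.
by apply: (index_inj x); rewrite mem_enum inE ?xP ?yP ?lxy /=.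
Qed.

(** Cycles are paired with cycles of equal length. In walk coordinates [e] and [f] act by shifts
    depending only on parity and cycle length, so following the walks commutes with both. *)
Lemma matched_pairs_iso (T T' : finType) (e f : T -> T) (e' f' : T' -> T') :
    matching e -> matching f -> matching e' -> matching f' ->
    ctype e f = ctype e' f' -> #|T| = #|T'| ->
  exists h : T -> T', [/\ bijective h, forall i, h (e i) = e' (h i)
                        & forall i, h (f i) = f' (h i)].
Proof.
move=> eM fM eM' fM' ct cT.
have [g [gP g_inj]] := label_preserving_injection set0
  (ccomps_card_eq eM fM eM' fM' ct cT).
have inC i : ccomp e f i \in ccomps e f by apply: imset_f.
pose r := fingraph.root (adj e f); pose r' := fingraph.root (adj e' f').
have ri i : ccomp e f (r i) = ccomp e f i.
  by apply/esym/eqP; rewrite comp_eq // inE connect_root.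
have ri' i : ccomp e' f' (r' i) = ccomp e' f' i.
  by apply/esym/eqP; rewrite comp_eq // inE connect_root.
have rP i j : ccomp e f i = ccomp e f j -> r i = r j.
  by move/eqP; rewrite comp_eq // inE => /(fingraph.rootP (adj_connect_sym eM fM)).
have rP' i j : ccomp e' f' i = ccomp e' f' j -> r' i = r' j.
  by move/eqP; rewrite comp_eq // inE => /(fingraph.rootP (adj_connect_sym eM' fM')).
(* h follows the walk from the root of a component of T along the walk from
   the root of the component of T' assigned to it by g. *)
have /fin_all_exists[h hP] i : exists y, exists k y0,
    [/\ i = walk e f (r i) k, ccomp e' f' y0 = g (ccomp e f i)
      & y = walk e' f' (r' y0) k].
  have : i \in ccomp e f (r i) by rewrite -comp_eq // ri.
  case/compP=> // k ik; have [/imsetP[y0 _ gy0] _] := gP _ (inC i).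
  by exists (walk e' f' (r' y0) k), k, y0.
have hcomp i : ccomp e' f' (h i) = g (ccomp e f i).
  by have [k [y0 [_ <- ->]]] := hP i; rewrite comp_walk // ri'.
(* The choices made in [hP] are immaterial: two positions of the same point are congruent modulo the
   common cycle length. *)
have hwalk i k y0 : i = walk e f (r i) k -> ccomp e' f' y0 = g (ccomp e f i) ->
    h i = walk e' f' (r' y0) k.
  move=> ik gy0; have [k1 [y1 [ik1 gy1 ->]]] := hP i.
  rewrite (rP' y1 y0) ?gy1 //; apply/walk_eqP => //.
  rewrite ri' gy0 (gP _ (inC i)).2 -ri; apply/walk_eqP => //.
  by rewrite -ik1 -ik.
have h_inj : injective h.
  move=> i j hij; have gij : g (ccomp e f i) = g (ccomp e f j).
    by rewrite -!hcomp hij.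
  have rij := g_inj _ _ (inC i) (inC j) gij.
  have [k [y0 [ik gy0 hi]]] := hP i; have [l [y1 [jl gy1 hj]]] := hP j.
  rewrite ik jl (rP i j rij); apply/walk_eqP => //.
  rewrite ri -(gP _ (inC j)).2 -gy1 -ri'; apply/walk_eqP => //.
  by rewrite -hj -hij hi (rP' y0 y1) // gy0 gij.
exists h; split; first by apply: inj_card_bij; rewrite ?cT.
- move=> i; have [k [y0 [ik gy0 ->]]] := hP i.
  rewrite e_walk //; apply: hwalk; last by rewrite comp_e.
  by rewrite (rP (e i) i) ?comp_e // -e_walk // -ik.
- move=> i; have [k [y0 [ik gy0 ->]]] := hP i.
  rewrite f_walk //; apply: hwalk; last by rewrite comp_f.
  rewrite (rP (f i) i) ?comp_f // ri' gy0 (gP _ (inC i)).2 -[in #|_|]ri.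
  by rewrite -f_walk // -ik.
Qed.

Lemma ccomp_refl (T : finType) (e : T -> T) i :
  matching e -> ccomp e e i = [set i; e i].
Proof.
move=> eM; have [eK _] := matchingP _ eM.
apply/setP=> j; apply/compP/set2P => // [[k ->]|[]->]; last 2 first.
- by exists 0.
- by exists 1.
elim: k => [|k IH] /=; first by left.
by rewrite if_same; case: IH => ->; rewrite ?eK; [right | left].
Qed.

Lemma ctype_refl (T : finType) (e : T -> T) : matching e -> ctype e e = [::].
Proof.
move=> eM; rewrite /ctype; set s := filter _ _.
suff ->: s = [::] by [].
apply/eqP; rewrite -size_eq0 size_filter -leqn0 leqNgt -has_count -all_predC.
rewrite all_map; apply/allP=> C /=; rewrite mem_enum => /imsetP[i _ ->].
by rewrite ccomp_refl // cards2; case: (i != e i).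
Qed.

(** A single matching is the pair ([e], [e]), whose type is empty, so only the cardinalities
    matter. *)
Lemma matching_iso (T T' : finType) (e : T -> T) (e' : T' -> T') :
    matching e -> matching e' -> #|T| = #|T'| ->
  exists2 h : T -> T', bijective h & forall i, h (e i) = e' (h i).
Proof.
move=> eM eM' cT; have := matched_pairs_iso eM eM eM' eM'.
by rewrite !ctype_refl // => /(_ erefl cT) [h []]; exists h.
Qed.

(** * Counting the permutations that carry one matching to another *)

Definition flip_snd n (u : 'I_n * bool) : 'I_n * bool := (u.1, ~~ u.2).

Lemma flip_matching n : matching (@flip_snd n).
Proof.
apply/matchingP; split=> [[i b]|[i b]]; first by rewrite /flip_snd /= negbK.
by apply/eqP=> -[]; case: b.
Qed.

(** The hyperoctahedral group, that is, the centralizer of [flip_snd]. *)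
Definition signed_perm n (u : 'S_n * {ffun 'I_n -> bool}) (v : 'I_n * bool) :
  'I_n * bool := (u.1 v.1, v.2 (+) u.2 v.1).

Lemma signed_perm_inj n (u : 'S_n * {ffun 'I_n -> bool}) :
  injective (signed_perm u).
Proof.
by move=> [i b] [j c] [/perm_inj ij]; rewrite ij => /addIb /= ->.
Qed.

(** Transporting [e] and [m] to the model matching [flip_snd] turns the permutations counted into
    signed permutations. *)
Lemma card_intertwiners (T : finType) (e m : T -> T) n :
    matching e -> matching m -> #|T| = 2 * n ->
  #|[set x : {perm T} | [forall i, x (m i) == e (x i)]]| = 2 ^ n * n`!.
Proof.
move=> eM mM cT.
have cI : #|{: 'I_n * bool}| = #|T|.
  by rewrite card_prod card_ord card_bool cT mulnC.
have [h [h' hK h'K] he] := matching_iso (@flip_matching n) eM cI.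
have [g [g' gK g'K] gm] := matching_iso (@flip_matching n) mM cI.
have F_inj u : injective (fun i => h (signed_perm u (g' i))).
  move=> i j /(can_inj hK) /signed_perm_inj; exact: can_inj g'K _ _.
pose F u := perm (@F_inj u).
transitivity #|F @: [set: 'S_n * {ffun 'I_n -> bool}]|; last first.
  rewrite card_imset ?cardsT ?card_prod ?card_ffun ?card_bool ?card_ord.
    by rewrite card_Sn mulnC.
  move=> [s t] [s' t'] /permP eF.
  have eq i b : signed_perm (s, t) (i, b) = signed_perm (s', t') (i, b).
    by have := eF (g (i, b)); rewrite !permE gK => /(can_inj hK).
  congr (_, _); first by apply/permP=> i; have [] := eq i false.
  by apply/ffunP=> i; have [_] := eq i false.
apply: eq_card => x; rewrite inE; apply/forallP/imsetP => [xP|[u _ ->] i].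
  pose y v := h' (x (g v)).
  have yE v : x (g v) = h (y v) by rewrite /y h'K.
  have yf v : y (flip_snd v) = flip_snd (y v).
    by apply: (can_inj hK); rewrite -yE gm (eqP (xP _)) yE he.
  have y_inj : injective y by move=> v w /(can_inj h'K)/perm_inj/(can_inj gK).
  (* As [y] commutes with [flip_snd], it permutes the n pairs; this permutation is the unsigned
     part. *)
  have s_inj : injective (fun i => (y (i, false)).1).
    move=> i j ij; have [/y_inj[] //|ne] := eqVneq (y (i, false)) (y (j, false)).
    suff /y_inj[] : y (i, false) = y (flip_snd (j, false)) by [].
    rewrite yf; move: ij ne; case: (y (i, false)) => a b; case: (y (j, false)) => c d /= ->.
    by rewrite xpair_eqE eqxx /=; case: b; case: d.
  exists (perm s_inj, [ffun i => (y (i, false)).2]) => //.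
  apply/permP=> k; rewrite permE /signed_perm -[k in LHS]g'K; case: (g' k) => i b /=.
  rewrite permE ffunE yE; congr h; case: b; last by rewrite addFb; case: (y _).
  by rewrite -[(i, true)]/(flip_snd (i, false)) yf.
have gm' j : g' (m j) = flip_snd (g' j) by rewrite -{1}[j]g'K -gm gK.
apply/eqP; rewrite !permE gm' -he; congr h; rewrite /flip_snd /signed_perm /=.
by rewrite addNb.
Qed.

(** * Disagreement sets and unions of matched pairs *)

Section Support.

Variable T : finType.
Implicit Types (e f m : T -> T) (A B D : {set T}).

Definition dsupp e f : {set T} := [set i | f i != e i].

Definition stable e A : bool := [forall i, (e i \in A) == (i \in A)].

Lemma stableP e A : reflect (forall i, (e i \in A) = (i \in A)) (stable e A).
Proof. by apply: (iffP forallP) => eA i; apply/eqP; rewrite eA. Qed.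

Lemma dsupp_stable e f : matching e -> matching f -> stable e (dsupp e f).
Proof.
move=> /matchingP[eK _] /matchingP[fK _]; apply/stableP=> i; rewrite !inE eK.
congr (~~ _); apply/eqP/eqP => [fe|fi]; first by rewrite -{1}fe fK.
by rewrite -fi fK.
Qed.

(** The matchings agree at [i] exactly when the walk from [i] closes up after two steps. *)
Lemma mem_dsupp e f i : matching e -> matching f ->
  (i \in dsupp e f) = (#|ccomp e f i| != 2).
Proof.
move=> eM fM; have [eK _] := matchingP _ eM; have [fK _] := matchingP _ fM.
rewrite inE; congr (~~ _); apply/eqP/eqP => [fe|c2].
  have /(walk_eqP eM fM i 2 0) : walk e f i 2 = walk e f i 0 by rewrite /= -fe fK.
  have := comp_even eM fM i; have := comp_card_gt0 e f i.
  case: #|ccomp e f i| => [|[|[|c]]] // _ _.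
have /walk_eqP : 2 = 0 %[mod #|ccomp e f i|] by rewrite c2.
by move=> /(_ eM fM) /= fei; rewrite -[in LHS]fei fK.
Qed.

Lemma card_dsupp e f : matching e -> matching f ->
  #|dsupp e f| = 2 * part_w (ctype e f).
Proof.
move=> eM fM; rewrite -ctype_mass // big_mkcondr /=.
rewrite -sum1_card big_mkcond /=.
rewrite (eq_bigl [in [set: T]]) => [|i]; last by rewrite in_setT.
rewrite (set_partition_big _ (ccomps_partition eM fM)) /=.
apply: eq_bigr => C /imsetP[i _ ->].
rewrite (eq_bigr (fun=> (#|ccomp e f i| != 2 : nat))) => [|j].
  by rewrite sum_nat_const; case: eqP; rewrite ?muln0 ?muln1.
by rewrite -comp_eq // mem_dsupp // => /eqP ->; case: eqP.
Qed.

(** From each pair inside [B] the point of smaller rank is chosen. *)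
Lemma stable_transversal e B : matching e -> stable e B ->
  exists2 R : {set T}, [disjoint R & e @: R] & B = R :|: e @: R.
Proof.
move=> /matchingP[eK eN] /stableP eB.
exists [set i in B | enum_rank i < enum_rank (e i)].
  rewrite disjoints_subset; apply/subsetP=> i; rewrite !inE => /andP[_ lt1].
  by apply/imsetP=> -[j]; rewrite inE => /andP[_ lt2] ij; rewrite ij eK in lt1; lia.
apply/setP=> i; rewrite !inE; apply/idP/orP => [iB|[/andP[] //|/imsetP[j]]].
  have: enum_rank i != enum_rank (e i) :> nat.
    by apply: contraNneq (eN i) => /val_inj/enum_rank_inj <-.
  rewrite neq_ltn => /orP[lt1|lt1]; [by left; rewrite iB lt1|right].
  by apply/imsetP; exists (e i); rewrite ?inE ?eB ?eK ?iB.
by rewrite inE => /andP[jB _] ->; rewrite eB.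
Qed.

Lemma card_matched_union e (R : {set T}) : matching e ->
  [disjoint R & e @: R] -> #|R :|: e @: R| = 2 * #|R|.
Proof.
move=> /matchingP[eK _] dR; rewrite cardsU disjoint_setI0 // cards0 subn0.
by rewrite card_imset ?mul2n ?addnn //; apply: can_inj eK.
Qed.

(** Such a set is [D] together with k of the n - w pairs of [e] outside [D]; a transversal of the
    complement encodes the choice as a k-subset. *)
Lemma card_stable_supersets e D n w k :
    matching e -> stable e D -> #|T| = 2 * n -> #|D| = 2 * w ->
  #|[set A : {set T} | [&& D \subset A, stable e A & #|A| == 2 * (w + k)]]|
    = 'C(n - w, k).
Proof.
move=> eM eD cT cD; have [eK _] := matchingP _ eM.
have sC : stable e (~: D).
  by apply/stableP=> i; rewrite !inE (stableP _ _ eD).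
have [R dR RC] := stable_transversal eM sC.
have cR : #|R| = n - w.
  have := cardsC D; rewrite RC card_matched_union //; lia.
rewrite -cR -cards_draws; pose F B := D :|: (B :|: e @: B).
have FR B : B \subset R -> R :&: F B = B.
  move=> BR; apply/setP=> i; rewrite !inE; apply/andP/idP => [[iR]|iB]; last first.
    by rewrite (subsetP BR) // iB orbT.
  have iD : i \notin D by rewrite -in_setC RC inE iR.
  rewrite (negPf iD) /= => /orP[//|/(subsetP (imsetS e BR)) ieR].
  by have /setDidPl := dR; move=> /setP/(_ i); rewrite !inE iR ieR.
have FD B : B \subset R -> [disjoint D & B :|: e @: B].
  move=> BR; rewrite -setI_eq0 -subset0 -(setICr D) setIS // RC.
  by rewrite setUSS ?imsetS.
have dB B : B \subset R -> [disjoint B & e @: B].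
  by move=> BR; apply: (disjointWl BR); apply: (disjointWr (imsetS e BR)).
have F_inj : {in [set B : {set T} | B \subset R & #|B| == k] &, injective F}.
  move=> B B'; rewrite !inE => /andP[BR _] /andP[BR' _] FF.
  by rewrite -(FR B BR) FF FR.
rewrite -(card_in_imset F_inj); apply: eq_card => A; rewrite inE.
apply/and3P/imsetP => [[DA eA /eqP cA]|[B]]; last first.
  rewrite inE => /andP[BR /eqP cB] ->; split; first exact: subsetUl.
    have inm j : (j \in e @: B) = (e j \in B).
      by rewrite -{1}[j]eK (mem_imset _ _ (can_inj eK)).
    apply/stableP=> i; rewrite !inE (stableP _ _ eD) !inm eK.
    by rewrite (orbC (i \in B)).
  rewrite cardsU (disjoint_setI0 (FD B BR)) cards0 subn0.
  by rewrite card_matched_union ?dB // cB cD mulnDr.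
have AE : A = F (R :&: A).
  apply/setP=> i; rewrite /F !inE; case iD: (i \in D) => /=.
    by rewrite (subsetP DA).
  have iR : (i \in R) || (i \in e @: R) by rewrite -in_setU -RC inE iD.
  apply/idP/orP => [iA|[/andP[] //|/imsetP[j]]]; last first.
    by rewrite inE => /andP[_ jA] ->; rewrite (stableP _ _ eA).
  case/orP: iR => [->|/imsetP[j jR ij]]; [by left; rewrite iA | right].
  by apply/imsetP; exists j; rewrite // inE jR -(stableP _ _ eA) -ij.
exists (R :&: A) => //; rewrite inE subsetIl /=.
move: cA; rewrite {1}AE cardsU (disjoint_setI0 (FD _ (subsetIl _ _))) cards0.
rewrite card_matched_union ?dB ?subsetIl //; lia.
Qed.

(** * Intermediate matchings sorted by their support *)

Definition intermediates mu la e f : {set {ffun T -> T}} :=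
  [set m : {ffun T -> T} | [&& matching m, ctype e m == mu & ctype m f == la]].

Definition esupp e f m : {set T} := dsupp e m :|: dsupp e f.

Definition essential mu la e f (A : {set T}) : {set {ffun T -> T}} :=
  [set m : {ffun T -> T} in intermediates mu la e f | esupp e f m == A].

End Support.

(** A matching of [T0] is extended by [e] outside the image of [h], which changes neither type;
    conversely, a matching supported on the image agrees with [e] elsewhere. *)
Lemma card_essential_embed (T0 T : finType) mu la (e0 f0 : T0 -> T0)
    (e f : T -> T) (h : T0 -> T) :
    matching e0 -> matching f0 -> matching e -> matching f ->
    injective h -> (forall i, h (e0 i) = e (h i)) ->
    (forall i, h (f0 i) = f (h i)) ->
    (forall y, y \notin codom h -> f y = e y) ->
  #|essential mu la e f [set h i | i : T0]| = #|essential mu la e0 f0 setT|.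
Proof.
move=> eM0 fM0 eM fM h_inj he hf off; have [eK eN] := matchingP _ eM.
pose push (m : {ffun T0 -> T0}) : {ffun T -> T} :=
  [ffun y => if [pick i | h i == y] is Some i then h (m i) else e y].
have pushh m i : push m (h i) = h (m i).
  by rewrite ffunE; case: pickP => [j /eqP/h_inj ->|/(_ i)] //; rewrite eqxx.
have pusho m y : y \notin codom h -> push m y = e y.
  move=> yh; rewrite ffunE; case: pickP => // i /eqP hi.
  by rewrite -hi codom_f in yh.
have eoff y : y \notin codom h -> e y \notin codom h.
  apply: contra => /codomP[i ei]; apply/codomP; exists (e0 i).
  by rewrite he -ei eK.
have pushM (m : {ffun T0 -> T0}) : matching m -> matching (push m).
  move=> /matchingP[mK mN]; apply/matchingP; split=> y;
    case: (boolP (y \in codom h)) => [/codomP[i ->]|yh].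
  - by rewrite !pushh mK.
  - by rewrite !pusho ?eoff.
  - by rewrite pushh (inj_eq h_inj).
  - by rewrite pusho.
have push_inj : injective push.
  move=> m m' /ffunP mm; apply/ffunP=> i; apply: h_inj.
  by rewrite -!pushh mm.
have pushP (m : {ffun T0 -> T0}) : matching m ->
    (push m \in essential mu la e f [set h i | i : T0]) =
    (m \in essential mu la e0 f0 setT).
  move=> mM; have pM := pushM m mM; rewrite !inE mM pM /=.
  have hm i : h (m i) = push m (h i) by rewrite pushh.
  rewrite -(ctype_embed eM0 mM eM pM h_inj he hm (fun y => @pusho m y)).
  rewrite -(ctype_embed mM fM0 pM fM h_inj hm hf) => [|y yh]; last first.
    by rewrite pusho ?off.
  congr (_ && _); apply/eqP/eqP => [/setP sE|/setP sE]; apply/setP.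
    move=> i; have := sE (h i); rewrite !inE pushh -he -hf !(inj_eq h_inj).
    by rewrite imset_f.
  move=> y; rewrite !inE; case: (boolP (y \in codom h)) => [/codomP[i ->]|yh].
    rewrite imset_f //; have := sE i.
    by rewrite !inE pushh -he -hf !(inj_eq h_inj).
  rewrite pusho // off // eqxx; apply/esym/negbTE; apply: contra yh.
  by case/imsetP=> i _ ->; apply: codom_f.
rewrite -[RHS](card_imset _ push_inj); apply: eq_card => m.
apply/idP/imsetP => [mE|[m0 m0E ->]]; last first.
  by rewrite pushP //; move: m0E; rewrite !inE => /andP[/and3P[]].
have [mM /eqP/setP ms] : matching m /\ esupp e f m == [set h i | i : T0].
  by move: mE; rewrite !inE => /andP[/and3P[]].
have [mK mN] := matchingP _ mM.
have moff y : y \notin codom h -> m y = e y.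
  move=> yh; have := ms y; rewrite !inE; have -> : (y \in [set h i | i : T0]) = false.
    by apply/negbTE; apply: contra yh => /imsetP[i _ ->]; apply: codom_f.
  by case: eqP.
(* If [m] moved [h i] out of the image, it would act there as [e], which preserves the complement,
   and could not return to [h i]. *)
have /fin_all_exists[m0 m0P] i : exists j, m (h i) = h j.
  apply/codomP; apply/negPn/negP=> yh; have := moff _ yh.
  by rewrite mK => hi; have := eoff _ yh; rewrite -hi codom_f.
have mE0 : m = push [ffun i => m0 i].
  apply/ffunP=> y; case: (boolP (y \in codom h)) => [/codomP[i ->]|yh].
    by rewrite pushh ffunE m0P.
  by rewrite pusho // moff.
have m0M : matching [ffun i => m0 i].
  apply/matchingP; split=> i; first by apply: h_inj; rewrite !ffunE -!m0P mK.
  by rewrite ffunE -(inj_eq h_inj) -m0P mN.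
by exists [ffun i => m0 i]; rewrite // -pushP -?mE0.
Qed.

(** * Restriction of matchings to a stable set *)

Section Restriction.

Variables (T : finType) (A : {set T}).

(* The value is junk, namely u itself, when g maps val u outside A. *)
Definition restr (g : T -> T) (u : {x | x \in A}) : {x | x \in A} :=
  insubd u (g (val u)).

Lemma val_restr g u : stable g A -> val (restr g u) = g (val u).
Proof. by move=> /stableP gA; rewrite val_insubd gA (valP u). Qed.

Lemma restr_matching g : matching g -> stable g A -> matching (restr g).
Proof.
move=> /matchingP[gK gN] gA; apply/matchingP; split=> u.
  by apply: val_inj; rewrite !val_restr.
by rewrite -(inj_eq val_inj) val_restr.
Qed.

(** Off [A] the map [f] coincides with [e], so it preserves the complement of [A] and hence [A]. *)
Lemma stable_of_dsupp (e f : T -> T) : matching e -> matching f ->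
  stable e A -> dsupp e f \subset A -> stable f A.
Proof.
move=> eM fM eA DA; have [eK _] := matchingP _ eM; have [fK _] := matchingP _ fM.
have out i : i \notin A -> f i = e i.
  by move=> iA; apply/eqP; apply: contraNT iA => fe; rewrite (subsetP DA) // inE.
apply/stableP=> i; case: (boolP (i \in A)) => iA; last first.
  by rewrite out // (stableP _ _ eA) (negPf iA).
apply: contraT => fiA; have := out _ fiA; rewrite fK => ie.
by rewrite ie (stableP _ _ eA) (negPf fiA) in iA.
Qed.

Section Pair.

Variables e f : T -> T.
Hypotheses (eM : matching e) (fM : matching f).
Hypotheses (eA : stable e A) (DA : dsupp e f \subset A).

Let fA : stable f A. Proof. exact: stable_of_dsupp eA DA. Qed.

Let he (u : {x | x \in A}) : val (restr e u) = e (val u).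
Proof. exact: val_restr. Qed.

Let hf (u : {x | x \in A}) : val (restr f u) = f (val u).
Proof. exact: val_restr. Qed.

Let off y : y \notin codom (val : {x | x \in A} -> T) -> f y = e y.
Proof.
move=> yA; apply/eqP; apply: contraNT yA => fe.
have yA : y \in A by rewrite (subsetP DA) // inE.
by apply/codomP; exists (exist _ y yA).
Qed.

Lemma ctype_restr : ctype (restr e) (restr f) = ctype e f.
Proof. by apply: ctype_embed val_inj he hf off; rewrite ?restr_matching. Qed.

Lemma card_essential_restr mu la :
  #|essential mu la e f A| = #|essential mu la (restr e) (restr f) setT|.
Proof.
rewrite -(card_essential_embed (h := val) mu la _ _ eM fM _ he hf off) //.
- congr #|essential _ _ _ _ _|; apply/setP=> y; apply/idP/imsetP => [yA|[u _ ->]].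
    by exists (exist _ y yA).
  exact: valP.
- exact: restr_matching.
- exact: restr_matching.
exact: val_inj.
Qed.

End Pair.
End Restriction.

(** Intermediate matchings are grouped by support, and supports by size. Restriction to the support
    makes it the whole carrier, where the assumption on [h] gives the count. *)
Lemma card_intermediates (T : finType) (mu la : seq nat) (e f : T -> T) n
    (h : 'I_(part_w mu).+1 -> nat) :
    matching e -> matching f -> #|T| = 2 * n ->
    (forall (T0 : finType) (e0 f0 : T0 -> T0) (k : 'I_(part_w mu).+1),
       matching e0 -> matching f0 ->
       ctype e0 f0 = ctype e f -> #|T0| = 2 * (part_w (ctype e f) + k) ->
       #|essential mu la e0 f0 setT| = h k) ->
  #|intermediates mu la e f|
    = \sum_(k < (part_w mu).+1) 'C(n - part_w (ctype e f), k) * h k.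
Proof.
move=> eM fM cT hP; set w := part_w (ctype e f).
have cD : #|dsupp e f| = 2 * w by apply: card_dsupp.
(* The possible supports: the bound holds because [dsupp e m] has twice [part_w mu] elements. *)
pose Q (A : {set T}) := [&& dsupp e f \subset A, stable e A & #|A| <= 2 * (w + part_w mu)].
have suppQ (m : {ffun T -> T}) : m \in intermediates mu la e f -> Q (esupp e f m).
  rewrite inE => /and3P[mM /eqP em _]; rewrite /Q subsetUr /=; apply/andP; split.
    apply/stableP=> i; have /stableP eDm := dsupp_stable eM mM.
    by have /stableP eDf := dsupp_stable eM fM; rewrite !in_setU eDm eDf.
  rewrite cardsU (leq_trans (leq_subr _ _)) // cD card_dsupp // em; lia.
have Qeven A : Q A -> exists2 k, k <= part_w mu & #|A| = 2 * (w + k).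
  case/and3P=> DA eA cA; have [R dR AR] := stable_transversal eM eA.
  have cAR : #|A| = 2 * #|R| by rewrite AR card_matched_union.
  have := subset_leq_card DA; rewrite cD => DA'.
  by exists (#|R| - w); lia.
rewrite -sum1_card (partition_big (fun m : {ffun T -> T} => esupp e f m) Q) //=.
(* This recovers k from [#|A|] = 2(w + k); the bound in [Q] keeps it within the range of [inord]. *)
pose p (A : {set T}) : 'I_(part_w mu).+1 := inord (#|A|./2 - w).
rewrite (partition_big p predT) //=; apply: eq_bigr => k _.
rewrite -(card_stable_supersets k eM (dsupp_stable eM fM) cT cD).
rewrite -sum_nat_const; apply: congr_big => // A; last first.
  case/andP=> QA /eqP pA; have [j jw cA] := Qeven A QA.
  have jk : j = k :> nat by rewrite -pA inordK; lia.
  case/and3P: QA => DA eA _; have fA := stable_of_dsupp eM fM eA DA.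
  rewrite -(hP _ (restr (A := A) e) (restr (A := A) f) k) ?restr_matching //.
  - rewrite -card_essential_restr // -sum1_card; apply: eq_bigl => m.
    by rewrite [RHS]inE.
  - exact: ctype_restr.
  by rewrite card_sig -jk -cA; apply: eq_card.
rewrite inE /Q; case DA: (_ \subset _) => //=; case eA: (stable e A) => //=.
apply/andP/eqP => [[cA /eqP pA]|cA].
  have QA : Q A by rewrite /Q DA eA.
  have [j jw cA'] := Qeven A QA.
  by rewrite cA' -pA inordK; lia.
have := ltn_ord k; rewrite cA => kw; split; first by lia.
by apply/eqP/val_inj; rewrite /p cA /= inordK; lia.
Qed.

(** * From permutations and group ring coefficients to matchings *)

Definition conjm (T : finType) (x : {perm T}) (e : T -> T) : T -> T :=
  fun i => (x^-1)%g (e (x i)).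

Lemma conjm_matching (T : finType) (x : {perm T}) e :
  matching e -> matching (conjm x e).
Proof.
move=> /matchingP[eK eN]; apply/matchingP; split=> i; rewrite /conjm.
  by rewrite permKV eK permK.
by rewrite -(inj_eq (@perm_inj _ x)) permKV.
Qed.

(** In a factorization of [z] the left factor determines the right one. *)
Lemma card_product_fiber (gT : finGroupType) (A B : {set gT}) (z : gT) :
  gring_mul (set_sum A) (set_sum B) z = #|[set x in A | (x^-1 * z)%g \in B]|%:R%R.
Proof.
have setE (C : {set gT}) y : set_sum C y = (y \in C)%:R%R.
  rewrite /set_sum sum_ffunE.
  under eq_bigr => x _ do rewrite ffunE.
  case yC: (y \in C).
    rewrite (bigD1 y) //= eqxx big1 ?addr0 // => x /andP[_ /negPf].
    by rewrite eq_sym => ->.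
  by rewrite big1 // => x xC; case: eqP => // yx; rewrite yx xC in yC.
rewrite ffunE -sum1_card natr_sum [RHS]big_mkcond /=; apply: eq_bigr => x _.
rewrite (big_pred1 (x^-1 * z)%g) => [|y]; last first.
  by rewrite /= (canF_eq (mulKg x)).
by rewrite !setE inE; case: (x \in A); case: (_ \in B); rewrite ?mulr0 ?mul0r ?mulr1.
Qed.

Section Standard.

Variable n : nat.

(** The default of [insubd] is never reached: an even index below 2n has its successor below 2n. *)
Definition std (i : 'I_(2 * n)) : 'I_(2 * n) :=
  insubd i (if odd i then i.-1 else i.+1).

Lemma val_std i : std i = (if odd i then i.-1 else i.+1) :> nat.
Proof. by rewrite val_insubd; have := ltn_ord i; case: ifP => //; case: ifP; lia. Qed.

Lemma pairedE i j : paired i j = (j == std i).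
Proof.
rewrite /paired -!(inj_eq val_inj) /= val_std.
by case: ifP; lia.
Qed.

Lemma std_matching : matching std.
Proof.
apply/matchingP; split=> i.
  by apply: val_inj; rewrite /= !val_std; case: (boolP (odd i)) => oi; case: ifP; lia.
by rewrite -(inj_eq val_inj) /= val_std; case: ifP; lia.
Qed.

(** Straight edges are those of [std], and curved edges those of its conjugate by [x]. *)
Lemma stable_coset_typeE (x : 'S_(2 * n)) :
  stable_coset_type x = ctype std (conjm x std).
Proof.
suff E : components x = ccomps std (conjm x std).
  by rewrite /stable_coset_type E.
apply: eq_imset => i; apply/setP=> j; rewrite !inE; apply: eq_connect => a b.
rewrite /Gamma /adj /straight_edge /curved_edge /= !pairedE; congr (_ || _).
by rewrite -[RHS](inj_eq (@perm_inj _ x)) /conjm permKV.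
Qed.

(** After [e] is transported to [std], a permutation carrying the transported [f] to [std] serves as
    [z]. *)
Lemma std_model (T : finType) (e f : T -> T) :
    matching e -> matching f -> #|T| = 2 * n ->
  exists2 z : 'S_(2 * n), stable_coset_type z = ctype e f &
  exists2 h : 'I_(2 * n) -> T, bijective h &
    (forall i, h (std i) = e (h i)) /\ (forall i, h (conjm z std i) = f (h i)).
Proof.
move=> eM fM cT; have [fK fN] := matchingP _ fM.
have [h h_bij he] : exists2 h : 'I_(2 * n) -> T, bijective h &
    forall i, h (std i) = e (h i).
  by apply: matching_iso; rewrite ?std_matching ?card_ord.
have [h' hK h'K] := h_bij.
pose f0 i := h' (f (h i)).
have f0M : matching f0.
  apply/matchingP; split=> i; first by rewrite /f0 h'K fK hK.
  by rewrite -(inj_eq (can_inj hK)) h'K.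
have [g g_bij gf] := matching_iso f0M std_matching erefl.
have zE i : h (conjm (perm (bij_inj g_bij)) std i) = f (h i).
  by rewrite /conjm permE -gf -[g _](permE (bij_inj g_bij)) permK /f0 h'K.
exists (perm (bij_inj g_bij)); last by exists h.
rewrite stable_coset_typeE.
apply: (ctype_embed std_matching (conjm_matching _ std_matching) eM fM
  (bij_inj h_bij) he zE) => y.
by have [i ->] : exists i, y = h i; [exists (h' y); rewrite h'K | rewrite codom_f].
Qed.

(** The map sending [x] to [conjm x std] lands in the intermediate matchings, and each fibre is a
    set of intertwiners with [std]. *)
Lemma card_perm_intermediates mu la (z : 'S_(2 * n)) :
  #|[set x in K mu n | (x^-1 * z)%g \in K la n]|
    = 2 ^ n * n`! * #|intermediates mu la std (conjm z std)|.
Proof.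
pose F (x : 'S_(2 * n)) : {ffun 'I_(2 * n) -> 'I_(2 * n)} := finfun (conjm x std).
have FE x : F x =1 conjm x std by move=> i; rewrite ffunE.
have FM x : matching (F x).
  by rewrite (eq_matching (FE x)) conjm_matching ?std_matching.
have xP x : (x \in [set x in K mu n | (x^-1 * z)%g \in K la n])
    = (F x \in intermediates mu la std (conjm z std)).
  rewrite !inE FM /= !stable_coset_typeE (eq_ctype (frefl std) (FE x)).
  congr (_ && (_ == la)).
  (* Relabelling by [x^-1] carries the pair of matchings attached to [x^-1 * z] to the pair ([F x],
     [conjm z std]). *)
  apply: (ctype_embed std_matching (conjm_matching _ std_matching) (FM x)
    (conjm_matching _ std_matching) (@perm_inj _ x^-1)).
  - by move=> i; rewrite FE /conjm permKV.
  - by move=> i; rewrite /conjm !permM invMg invgK !permM permK.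
  move=> y; have -> : y = (x^-1)%g (x y) by rewrite permK.
  by rewrite codom_f.
rewrite -sum1_card (partition_big F [in intermediates mu la std (conjm z std)]) /=.
  rewrite [RHS]mulnC -sum_nat_const; apply: eq_bigr => m mI.
  have mM : matching m by move: mI; rewrite inE => /and3P[].
  have cI : #|'I_(2 * n)| = 2 * n by rewrite card_ord.
  rewrite -(card_intertwiners std_matching mM cI) -sum1_card.
  apply: eq_bigl => x; rewrite xP inE; apply/andP/forallP => [[_ /eqP <-] i|xm].
    by rewrite FE /conjm permKV.
  suff -> : F x = m by rewrite mI.
  by apply/ffunP=> i; rewrite FE /conjm -(eqP (xm i)) permK.
by move=> x; rewrite xP.
Qed.

End Standard.

(** * Uniformity in n *)

Lemma K_nonempty_stable nu n n' : part_w nu <= n -> part_w nu <= n' ->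
  K nu n != set0 -> K nu n' != set0.
Proof.
move=> wn wn' /set0Pn[z]; rewrite inE stable_coset_typeE => /eqP ct.
have eM := std_matching n; have fM := conjm_matching z eM.
set f := conjm _ _ in ct fM; set D := dsupp (@std n) f.
have eD := dsupp_stable eM fM; have fD := stable_of_dsupp eM fM eD (subxx _).
(* Only the points of disagreement are kept, and pairs on which both matchings agree are added until
   the size is 2n'; neither operation affects the type. *)
pose U := 'I_(2 * (n' - part_w nu)); pose eU : U -> U := @std _.
pose T := ({x | x \in D} + U)%type.
pose g (k : {x | x \in D} -> {x | x \in D}) (u : T) : T :=
  match u with inl v => inl (k v) | inr v => inr (eU v) end.
have gM k : matching k -> matching (g k).
  move=> /matchingP[kK kN]; have /matchingP[eK eN] := std_matching (n' - part_w nu).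
  apply/matchingP; split=> [] [u|u] /=; rewrite /eU ?kK ?eK //.
    by apply/eqP=> -[ku]; have := kN u; rewrite ku eqxx.
  by apply/eqP=> -[eu]; have := eN u; rewrite -[X in _ != X]eu eqxx.
have cT : #|{: T}| = 2 * n'.
  rewrite card_sum card_ord card_sig (eq_card (B := D)) //.
  by rewrite card_dsupp // ct; lia.
have reM := restr_matching eM eD; have rfM := restr_matching fM fD.
have [z' zE _] := std_model (gM _ reM) (gM _ rfM) cT.
apply/set0Pn; exists z'; rewrite inE zE; apply/eqP/esym.
rewrite -[LHS]ct -(ctype_restr eM fM eD (subxx _)).
have inl_inj : injective (inl : {x | x \in D} -> T) by move=> u v [].
apply: (ctype_embed reM rfM (gM _ reM) (gM _ rfM) inl_inj) => //.
by move=> [u|u] //; rewrite codom_f.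
Qed.

(** The count is read off at one standard model, to which all pairs of this type and size are
    isomorphic. If there is no model, no such pair exists and the value 0 is harmless. *)
Lemma essential_count_exists mu la nu k : exists c,
  forall (T : finType) (e f : T -> T), matching e -> matching f ->
    ctype e f = nu -> #|T| = 2 * (part_w nu + k) ->
    #|essential mu la e f setT| = c.
Proof.
pose n := part_w nu + k.
pose c := if [pick z in K nu n] is Some z
  then #|essential mu la (@std n) (conjm z (@std n)) setT| else 0.
exists c => T e f eM fM ct cT; rewrite /c; case: pickP => [z|none]; last first.
  by have [z zE _] := std_model eM fM cT; have := none z; rewrite inE zE ct eqxx.
rewrite inE stable_coset_typeE => /eqP zE.
have sM := std_matching n; have zM := conjm_matching z sM.
have cI : #|'I_(2 * n)| = #|T| by rewrite card_ord.
have [h [h_bij he hf]] := matched_pairs_iso sM zM eM fM (etrans zE (esym ct)) cI.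
have [h' _ h'K] := h_bij.
rewrite -(card_essential_embed mu la sM zM eM fM (bij_inj h_bij) he hf).
  congr #|essential _ _ _ _ _|; apply/setP=> y; rewrite inE; apply/esym/imsetP.
  by exists (h' y).
by move=> y; rewrite -[y]h'K codom_f.
Qed.

(** The coefficients [h] are chosen before n, so n enters the sum only through the binomials. *)
Lemma structure_constE mu la nu : K nu (part_w nu) != set0 ->
  exists h : 'I_(part_w mu).+1 -> nat, forall n, part_w nu <= n ->
    structure_const mu la nu n = (2 ^ n * n`! *
      \sum_(k < (part_w mu).+1) 'C(n - part_w nu, k) * h k)%:R%R.
Proof.
move=> Kw.
have /fin_all_exists[h hP] (k : 'I_(part_w mu).+1) :=
  essential_count_exists mu la nu k.
exists h => n wn; rewrite /structure_const.
have /set0Pn[z0 z0K] := K_nonempty_stable (leqnn _) wn Kw.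
case: pickP => [z|/(_ z0)]; last by rewrite z0K.
rewrite inE stable_coset_typeE => /eqP zE; rewrite card_product_fiber.
rewrite card_perm_intermediates; congr (_ * _)%:R%R.
have sM := std_matching n; have zM := conjm_matching z sM.
have cI : #|'I_(2 * n)| = 2 * n by rewrite card_ord.
have := card_intermediates (mu := mu) (la := la) sM zM cI; rewrite zE; apply.
by move=> T0 e0 f0 k; apply: hP.
Qed.

(** * Polynomiality *)

Local Open Scope ring_scope.

(** Induction through (k + 1) C(m, k + 1) = (m - k) C(m, k). *)
Lemma bin_poly (k : nat) :
  exists p : {poly rat}, forall m : nat, ('C(m, k))%:R = p.[m%:R].
Proof.
elim: k => [|k [p pE]]; first by exists 1 => m; rewrite bin0 hornerE.
exists ((k.+1%:R)^-1 *: (('X - k%:R%:P) * p)) => m.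
have k0 : (k.+1%:R : rat) != 0 by rewrite Num.Theory.pnatr_eq0.
rewrite hornerZ hornerM hornerXsubC -pE; apply: (mulfI k0); rewrite mulVKf //.
(* For m < k the truncated difference is not the rational one, but C(m, k) vanishes. *)
rewrite -natrM mul_bin_left; case: (leqP k m) => km.
  by rewrite natrM natrB.
by rewrite bin_small // muln0 mulr0.
Qed.

Theorem theorem3p1 (mu la nu : seq nat)
    (mu_part : is_part mu) (la_part : is_part la) (nu_part : is_part nu) :
  exists (f : {poly rat}) (N : nat), forall n : nat, (N <= n)%N ->
    (structure_const mu la nu n)%:~R
      = (2%:R : rat) ^ (n%:Z - (part_w nu)%:Z) * (n`!)%:R * f.[n%:R].
Proof.
set w := part_w nu; case: (boolP (K nu w == set0)) => [/eqP Kw|Kw].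
  (* Here [K nu n] is empty for all n >= w, and [structure_const] takes its default value 0. *)
  exists 0, w => n wn; rewrite horner0 mulr0 /structure_const.
  case: pickP => // z zK; suff : K nu w != set0 by rewrite Kw eqxx.
  by apply: K_nonempty_stable wn _ _ => //; apply/set0Pn; exists z.
have [h hP] := structure_constE mu la Kw.
have /fin_all_exists[p pE] (k : 'I_(part_w mu).+1) := bin_poly k.
(* The factor 2^w compensates for the exponent n - w in the statement, and the composition evaluates
   [p k] at n - w. *)
exists (2%:R ^+ w *: \sum_k (h k)%:R *: (p k \Po ('X - w%:R%:P))), w => n wn.
rewrite hP // natz -pmulrn !natrM natrX hornerZ horner_sum.
have -> : (n%:Z - w%:Z) = (n - w)%N%:Z by rewrite subzn.
rewrite -exprnP [RHS]mulrA (mulrAC (_ ^+ (n - w))) -exprD subnK //; congr (_ * _).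
rewrite natr_sum; apply: eq_bigr => k _.
by rewrite hornerZ horner_comp hornerXsubC -natrB // -pE natrM mulrC.
Qed.
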